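(* Let $\mathbb{M}$ be a right proper model category in which every object is cofibrant, and let $\mathbb{M}_{\mathrm{f}}$ be the full subcategory of $\mathbb{M}$ on the fibrant objects. If $\mathbb{M}$ has weak dependent products, then $\mathbb{M}_{\mathrm{f}}$ has homotopy weak dependent products for every pair of composable fibrations.
   Context: Weak limits are defined as limits but without requiring uniqueness of the universal arrow. Weak dependent product. Let $Y\xrightarrow{y}X\xrightarrow{x}J$ be arrows in a category with weak finite limits. Consider diagrams over $y,x$ consisting of objects $U,V$ and arrows $u\colon U\to J$, $p_1\colon V\to U$, $p_2\colon V\to X$, $f\colon V\to Y$ with $yf=p_2$ and with $up_1=xp_2$ a weak pullback square. The arrow $f$ is determined by projections if $fa=fb$ for every pair $a,b\colon T\to V$ with $p_1a=p_1b$ and $p_2a=p_2b$. Such a diagram is a weak dependent product of $y,x$ if $f$ is determined by projections and, for every such diagram $(U',V',u',p_1',p_2',f')$ with $f'$ determined by projections, there are arrows $h\colon U'\to U$ and $l\colon V'\to V$ with $uh=u'$, $p_1l=hp_1'$, $p_2l=p_2'$, $fl=f'$. A category has weak dependent products if every composable pair has one. When all objects of $\mathbb{M}$ are cofibrant, $\mathbb{M}_{\mathrm{f}}$, with the fibrations and weak equivalences of $\mathbb{M}$, is a path category in the sense of van den Berg and Moerdijk (a category of fibrant objects in the sense of Brown in which every acyclic fibration has a section and weak equivalences coincide with homotopy equivalences). Fibrewise homotopy. For a fibration $g\colon B\to A$, a fibrewise path object $P_gB$ is a factorisation of the diagonal $B\to B\times_AB$ as an acyclic cofibration $B\to P_gB$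 followed by a fibration $P_gB\to B\times_AB$. For arrows $d,d'\colon C\to B$ with $gd=gd'$, write $d\simeq_g d'$ if $\langle d,d'\rangle\colon C\to B\times_AB$ factors through $P_gB\to B\times_AB$. Homotopy weak dependent product. Let $g\colon B\to A$ and $f\colon A\to I$ be fibrations in $\mathbb{M}_{\mathrm{f}}$. A homotopy weak dependent product of $f$ and $g$ consists of a fibration $u\colon U\to I$ and an arrow $e\colon U\times_IA\to B$ such that $ge$ is the projection $U\times_IA\to A$, and such that for every fibration $u'\colon U'\to I$ and arrow $e'\colon U'\times_IA\to B$ with $ge'$ equal to the projection $U'\times_IA\to A$, there is $k\colon U'\to U$ with $uk=u'$ and $e\circ(k\times A)\simeq_g e'$, where $k\times A\colon U'\times_IA\to U\times_IA$ is the induced arrow. *)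

(* Defs.v *)
From Stdlib Require Import List FinFun.

Set Implicit Arguments.
Unset Strict Implicit.
Unset Printing Implicit Defensive.

Declare Scope cat_scope.
Delimit Scope cat_scope with cat.
Local Open Scope cat_scope.

Record Category := {
  Ob :> Type;
  Hom : Ob -> Ob -> Type;
  idm : forall X, Hom X X;
  comp : forall X Y Z, Hom Y Z -> Hom X Y -> Hom X Z;
  comp_assoc : forall W X Y Z (h : Hom Y Z) (g : Hom X Y) (f : Hom W X),
    comp h (comp g f) = comp (comp h g) f;
  comp_idl : forall X Y (f : Hom X Y), comp (idm Y) f = f;
  comp_idr : forall X Y (f : Hom X Y), comp f (idm X) = f
}.
Arguments Hom {c} X Y.
Arguments idm {c} X.
Arguments comp {c X Y Z} g f : rename.

Notation "g ∘ f" := (comp g f) (at level 40, left associativity) : cat_scope.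

Definition arrow_class (C : Category) := forall X Y : C, Hom X Y -> Prop.

Definition full_subcategory (C : Category) (P : C -> Prop) : Category := {|
  Ob := {X : C | P X};
  Hom := fun X Y => Hom (proj1_sig X) (proj1_sig Y);
  idm := fun X => idm (proj1_sig X);
  comp := fun X Y Z g f => g ∘ f;
  comp_assoc := fun W X Y Z h g f => comp_assoc h g f;
  comp_idl := fun X Y f => comp_idl f;
  comp_idr := fun X Y f => comp_idr f
|}.

Definition restrict_class (C : Category) (P : C -> Prop) (K : arrow_class C) :
    arrow_class (full_subcategory P) :=
  fun X Y f => K (proj1_sig X) (proj1_sig Y) f.

Record Functor (J C : Category) := {
  fobj :> J -> C;
  fmap : forall i j : J, Hom i j -> Hom (fobj i) (fobj j);
  fmap_id : forall i, fmap (idm i) = idm (fobj i);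
  fmap_comp : forall (i j k : J) (b : Hom j k) (a : Hom i j),
    fmap (b ∘ a) = fmap b ∘ fmap a
}.

Definition finite_category (J : Category) : Prop :=
  Finite J /\ forall i j : J, Finite (Hom i j).

Definition is_cone (J C : Category) (D : Functor J C) (L : C)
    (pr : forall i, Hom L (D i)) : Prop :=
  forall (i j : J) (a : Hom i j), fmap D a ∘ pr i = pr j.

Definition is_limit (J C : Category) (D : Functor J C) (L : C)
    (pr : forall i, Hom L (D i)) : Prop :=
  is_cone pr /\
  forall (T : C) (t : forall i, Hom T (D i)), is_cone t ->
    exists! h : Hom T L, forall i, pr i ∘ h = t i.

Definition is_cocone (J C : Category) (D : Functor J C) (L : C)
    (inj : forall i, Hom (D i) L) : Prop :=
  forall (i j : J) (a : Hom i j), inj j ∘ fmap D a = inj i.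

Definition is_colimit (J C : Category) (D : Functor J C) (L : C)
    (inj : forall i, Hom (D i) L) : Prop :=
  is_cocone inj /\
  forall (T : C) (t : forall i, Hom (D i) T), is_cocone t ->
    exists! h : Hom L T, forall i, h ∘ inj i = t i.

Definition has_finite_limits (C : Category) : Prop :=
  forall (J : Category) (D : Functor J C), finite_category J ->
    exists (L : C) (pr : forall i, Hom L (D i)), is_limit pr.

Definition has_finite_colimits (C : Category) : Prop :=
  forall (J : Category) (D : Functor J C), finite_category J ->
    exists (L : C) (inj : forall i, Hom (D i) L), is_colimit inj.

Definition is_terminal (C : Category) (T : C) : Prop :=
  forall X : C, exists! t : Hom X T, True.

Definition is_initial (C : Category) (E : C) : Prop :=
  forall X : C, exists! t : Hom E X, True.

Definition is_weak_pullback (C : Category) (X Y Z P : C)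
    (f : Hom X Z) (g : Hom Y Z) (p1 : Hom P X) (p2 : Hom P Y) : Prop :=
  f ∘ p1 = g ∘ p2 /\
  forall (T : C) (a : Hom T X) (b : Hom T Y), f ∘ a = g ∘ b ->
    exists h : Hom T P, p1 ∘ h = a /\ p2 ∘ h = b.

Definition is_pullback (C : Category) (X Y Z P : C)
    (f : Hom X Z) (g : Hom Y Z) (p1 : Hom P X) (p2 : Hom P Y) : Prop :=
  f ∘ p1 = g ∘ p2 /\
  forall (T : C) (a : Hom T X) (b : Hom T Y), f ∘ a = g ∘ b ->
    exists! h : Hom T P, p1 ∘ h = a /\ p2 ∘ h = b.

Definition is_retract (C : Category) (A B X Y : C)
    (f : Hom A B) (g : Hom X Y) : Prop :=
  exists (i : Hom A X) (r : Hom X A) (j : Hom B Y) (s : Hom Y B),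
    r ∘ i = idm A /\ s ∘ j = idm B /\ g ∘ i = j ∘ f /\ f ∘ r = s ∘ g.

Definition retract_closed (C : Category) (K : arrow_class C) : Prop :=
  forall (A B X Y : C) (f : Hom A B) (g : Hom X Y),
    is_retract f g -> K X Y g -> K A B f.

Definition class_meet (C : Category) (K L : arrow_class C) : arrow_class C :=
  fun X Y f => K X Y f /\ L X Y f.

Definition class_lifts (C : Category) (K L : arrow_class C) : Prop :=
  forall (A B X Y : C) (i : Hom A B) (p : Hom X Y), K A B i -> L X Y p ->
  forall (t : Hom A X) (b : Hom B Y), p ∘ t = b ∘ i ->
    exists l : Hom B X, l ∘ i = t /\ p ∘ l = b.

Definition class_factors (C : Category) (K L : arrow_class C) : Prop :=
  forall (X Y : C) (f : Hom X Y),
    exists (Z : C) (i : Hom X Z) (p : Hom Z Y), K X Z i /\ L Z Y p /\ p ∘ i = f.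

(** Quillen's closed model categories: only finite (co)limits are required, and
    factorisations need not be functorial.  That each class contains the
    identities and is closed under composition follows from the axioms. *)
Record ModelStructure (C : Category) := {
  weq : arrow_class C;
  cof : arrow_class C;
  fib : arrow_class C;
  model_limits : has_finite_limits C;
  model_colimits : has_finite_colimits C;
  weq_comp : forall (X Y Z : C) (f : Hom X Y) (g : Hom Y Z),
    weq f -> weq g -> weq (g ∘ f);
  weq_cancel_l : forall (X Y Z : C) (f : Hom X Y) (g : Hom Y Z),
    weq g -> weq (g ∘ f) -> weq f;
  weq_cancel_r : forall (X Y Z : C) (f : Hom X Y) (g : Hom Y Z),
    weq f -> weq (g ∘ f) -> weq g;
  weq_retract : retract_closed weq;
  cof_retract : retract_closed cof;
  fib_retract : retract_closed fib;
  lift_acof_fib : class_lifts (class_meet cof weq) fib;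
  lift_cof_afib : class_lifts cof (class_meet fib weq);
  factor_acof_fib : class_factors (class_meet cof weq) fib;
  factor_cof_afib : class_factors cof (class_meet fib weq)
}.

Section ModelNotions.
Variables (C : Category) (M : ModelStructure C).

Definition acyclic_cof : arrow_class C := class_meet (cof M) (weq M).

Definition fibrant (X : C) : Prop :=
  exists (T : C) (t : Hom X T), is_terminal T /\ fib M t.

Definition cofibrant (X : C) : Prop :=
  exists (E : C) (t : Hom E X), is_initial E /\ cof M t.

Definition right_proper : Prop :=
  forall (X Y Z P : C) (w : Hom X Z) (p : Hom Y Z) (p1 : Hom P X) (p2 : Hom P Y),
    is_pullback w p p1 p2 -> weq M w -> fib M p -> weq M p2.

Definition fibrant_subcategory : Category := full_subcategory fibrant.

Definition fibrant_fib : arrow_class fibrant_subcategory :=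
  restrict_class (fib M).

Definition fibrant_acyclic_cof : arrow_class fibrant_subcategory :=
  restrict_class acyclic_cof.

End ModelNotions.

Section WeakDependentProducts.
Variable C : Category.

Definition wdp_diagram (Y X J : C) (y : Hom Y X) (x : Hom X J)
    (U V : C) (u : Hom U J) (p1 : Hom V U) (p2 : Hom V X) (f : Hom V Y) : Prop :=
  y ∘ f = p2 /\ is_weak_pullback u x p1 p2.

Definition determined_by_projections (Y X U V : C)
    (p1 : Hom V U) (p2 : Hom V X) (f : Hom V Y) : Prop :=
  forall (T : C) (a b : Hom T V),
    p1 ∘ a = p1 ∘ b -> p2 ∘ a = p2 ∘ b -> f ∘ a = f ∘ b.

Definition is_weak_dependent_product (Y X J : C) (y : Hom Y X) (x : Hom X J)
    (U V : C) (u : Hom U J) (p1 : Hom V U) (p2 : Hom V X) (f : Hom V Y) : Prop :=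
  wdp_diagram y x u p1 p2 f /\
  determined_by_projections p1 p2 f /\
  forall (U' V' : C) (u' : Hom U' J) (p1' : Hom V' U') (p2' : Hom V' X)
         (f' : Hom V' Y),
    wdp_diagram y x u' p1' p2' f' ->
    determined_by_projections p1' p2' f' ->
    exists (h : Hom U' U) (l : Hom V' V),
      u ∘ h = u' /\ p1 ∘ l = h ∘ p1' /\ p2 ∘ l = p2' /\ f ∘ l = f'.

Definition has_weak_dependent_products : Prop :=
  forall (Y X J : C) (y : Hom Y X) (x : Hom X J),
    exists (U V : C) (u : Hom U J) (p1 : Hom V U) (p2 : Hom V X) (f : Hom V Y),
      is_weak_dependent_product y x u p1 p2 f.

End WeakDependentProducts.

Section HomotopyWeakDependentProducts.
Variables (C : Category) (F AC : arrow_class C).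

(** [q1, q2 : BB -> B] is the fibre product of [B] with itself over [A]; the two
    equations say that [p ∘ r] is the diagonal of [B]. *)
Definition is_fibrewise_path_object (A B BB P : C) (g : Hom B A)
    (q1 q2 : Hom BB B) (r : Hom B P) (p : Hom P BB) : Prop :=
  is_pullback g g q1 q2 /\ AC r /\ F p /\
  q1 ∘ (p ∘ r) = idm B /\ q2 ∘ (p ∘ r) = idm B.

Definition fibrewise_homotopic (A B D : C) (g : Hom B A) (d d' : Hom D B) : Prop :=
  g ∘ d = g ∘ d' /\
  exists (BB P : C) (q1 q2 : Hom BB B) (r : Hom B P) (p : Hom P BB),
    is_fibrewise_path_object g q1 q2 r p /\
    exists h : Hom D P, q1 ∘ (p ∘ h) = d /\ q2 ∘ (p ∘ h) = d'.

(** The relation does not depend on the fibre product and path object used. *)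
Lemma fibrewise_homotopic_any (A B D BB P : C) (g : Hom B A) (d d' : Hom D B)
    (q1 q2 : Hom BB B) (r : Hom B P) (p : Hom P BB) :
  class_lifts AC F -> is_fibrewise_path_object g q1 q2 r p ->
  fibrewise_homotopic g d d' ->
  exists h : Hom D P, q1 ∘ (p ∘ h) = d /\ q2 ∘ (p ∘ h) = d'.
Proof.
intros lift [[sq univ] [_ [Fp [e1 e2]]]]
  [_ [BB' [P' [s1 [s2 [r' [p' [[[sq' _] [ACr' [_ [e1' e2']]]] [h [h1 h2]]]]]]]]]].
destruct (univ P' (s1 ∘ p') (s2 ∘ p')) as [m [[m1 m2] _]].
{ now rewrite !comp_assoc, sq'. }
destruct (lift _ _ _ _ r' p ACr' Fp r m) as [l [_ pl]].
{ destruct (univ B (idm B) (idm B) eq_refl) as [k [_ uk]].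
  rewrite <- (uk (p ∘ r)), <- (uk (m ∘ r')); [reflexivity | |]; split; trivial.
  - now rewrite comp_assoc, m1, <- comp_assoc.
  - now rewrite comp_assoc, m2, <- comp_assoc. }
exists (l ∘ h); rewrite (comp_assoc p), pl, !comp_assoc, m1, m2, <- !comp_assoc.
now split.
Qed.

(** [p1, p2] exhibit [UA] as the fibre product of [U] and [A] over [I], and
    [kA] is the arrow induced by [k] on fibre products. *)
Definition is_homotopy_weak_dependent_product (B A I : C)
    (g : Hom B A) (f : Hom A I) (U UA : C) (u : Hom U I)
    (p1 : Hom UA U) (p2 : Hom UA A) (e : Hom UA B) : Prop :=
  F u /\ is_pullback u f p1 p2 /\ g ∘ e = p2 /\
  forall (U' UA' : C) (u' : Hom U' I) (p1' : Hom UA' U') (p2' : Hom UA' A)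
         (e' : Hom UA' B),
    F u' -> is_pullback u' f p1' p2' -> g ∘ e' = p2' ->
    exists (k : Hom U' U) (kA : Hom UA' UA),
      u ∘ k = u' /\ p1 ∘ kA = k ∘ p1' /\ p2 ∘ kA = p2' /\
      fibrewise_homotopic g (e ∘ kA) e'.

Definition has_homotopy_weak_dependent_products : Prop :=
  forall (B A I : C) (g : Hom B A) (f : Hom A I), F g -> F f ->
    exists (U UA : C) (u : Hom U I) (p1 : Hom UA U) (p2 : Hom UA A) (e : Hom UA B),
      is_homotopy_weak_dependent_product g f u p1 p2 e.

End HomotopyWeakDependentProducts.

(* Main.v *)
From Stdlib Require Import List.
Require Import Defs.

(** The weak dependent product of [g : B -> A] and [f : A -> I], taken in the
    model category, amounts to an object [U0] over [I] (in general not fibrant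
    over it) with an arrow [e0 : U0 ×_I A -> B] over [A] that is weakly
    universal for strict equality: the weak pullback that carries the evaluation
    arrow can be replaced by a genuine one, because an arrow determined by
    projections factors through it ([strict_weak_dependent_product]).

    To make [U0] fibrant over [I], factor [U0 -> I] as an acyclic cofibration
    [c : U0 -> U] followed by a fibration.  The arrow
    [c × A : U0 ×_I A -> U ×_I A] is the base change of [c] along the fibration
    [U ×_I A -> U], hence a weak equivalence by right properness.  It need not
    be a cofibration, so [e0] need not extend along it strictly; but all
    objects are cofibrant, so [e0] extends along it up to fibrewise homotopy
    ([homotopy_extension_along_weq]), and the extension [e] is the evaluation
    arrow looked for.  Given [e' : U' ×_I A -> B], take [h : U' -> U0] with
    [e0 ∘ (h × A) = e']; composing with [c] gives [k], and
    [e ∘ (k × A) ≃_g e0 ∘ (h × A) = e'].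

    This argument takes place in the model category
    ([has_homotopy_weak_dependent_products_model]).  It restricts to fibrant
    objects because [U], [U ×_I A] and the path objects of [g] map by
    fibrations to [I] or [B], and because a pullback of a fibration computed
    among fibrant objects is a pullback in the model category
    ([is_pullback_of_fibrant]). *)

Local Open Scope cat_scope.

(** * Pullbacks *)

Inductive cospan_object := cospan_left | cospan_right | cospan_base.

(** Every hom-set has at most one element, so that all equations between arrows
    hold by case analysis. *)
Definition cospan_hom (i j : cospan_object) : Type :=
  match i, j with
  | cospan_left, cospan_left | cospan_right, cospan_right
  | _, cospan_base => unit
  | _, _ => Empty_set
  end.

Definition cospan_category : Category.
Proof.
unshelve refine {| Ob := cospan_object; Hom := cospan_hom |}.
- intros []; exact tt.
- intros [] [] []; simpl; intros; trivial; contradiction.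
- intros [] [] [] [] [] [] []; reflexivity.
- intros [] [] []; reflexivity.
- intros [] [] []; reflexivity.
Defined.

Lemma finite_cospan_category : finite_category cospan_category.
Proof.
split.
- exists (cospan_left :: cospan_right :: cospan_base :: nil); intros []; simpl; auto.
- intros [] []; simpl;
    solve [exists nil; intros [] | exists (tt :: nil); intros []; now left].
Qed.

Section CospanFunctor.
Variables (C : Category) (X Y Z : C) (f : Hom X Z) (g : Hom Y Z).

Definition cospan_functor : Functor cospan_category C.
Proof.
unshelve refine {| fobj := fun i : cospan_category =>
  match i with cospan_left => X | cospan_right => Y | cospan_base => Z end |}.
- intros [] []; simpl; intros []; solve [exact (idm _) | exact f | exact g].
- intros []; reflexivity.
- intros [] [] [] [] []; simpl; now rewrite ?comp_idl, ?comp_idr.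
Defined.

Definition cospan_cone (T : C) (a : Hom T X) (b : Hom T Y) (i : cospan_category) :
    Hom T (cospan_functor i) :=
  match i with cospan_left => a | cospan_right => b | cospan_base => f ∘ a end.

Lemma is_cone_cospan_cone (T : C) (a : Hom T X) (b : Hom T Y) :
  f ∘ a = g ∘ b -> is_cone (cospan_cone T a b).
Proof. intros sq [] [] []; simpl; now rewrite ?comp_idl. Qed.

Lemma pullback_exists :
  has_finite_limits C ->
  exists (P : C) (p1 : Hom P X) (p2 : Hom P Y), is_pullback f g p1 p2.
Proof.
intros lim.
destruct (lim _ cospan_functor finite_cospan_category) as [P [pr [cone univ]]].
pose proof (cone cospan_left cospan_base tt) as cl.
pose proof (cone cospan_right cospan_base tt) as cr.
exists P, (pr cospan_left), (pr cospan_right); split.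
{ simpl in cl, cr; now rewrite cl, cr. }
intros T a b sq.
destruct (univ T _ (is_cone_cospan_cone T a b sq)) as [h [Eh uh]].
exists h; split.
- split; [exact (Eh cospan_left) | exact (Eh cospan_right)].
- intros k [k1 k2]; apply uh; intros []; [exact k1 | exact k2 |].
  simpl in cl |- *; now rewrite <- cl, <- comp_assoc, k1.
Qed.

End CospanFunctor.

Lemma is_pullback_jointly_monic (C : Category) (X Y Z P T : C)
    (f : Hom X Z) (g : Hom Y Z) (p1 : Hom P X) (p2 : Hom P Y) (a b : Hom T P) :
  is_pullback f g p1 p2 -> p1 ∘ a = p1 ∘ b -> p2 ∘ a = p2 ∘ b -> a = b.
Proof.
intros [sq univ] E1 E2.
destruct (univ T (p1 ∘ b) (p2 ∘ b)) as [h [_ uh]].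
{ now rewrite !comp_assoc, sq. }
now rewrite <- (uh a), <- (uh b).
Qed.

(** Cancellation half of the pasting law for pullback squares. *)
Lemma is_pullback_cancel (C : Category) (X X0 Y Z P P0 : C)
    (f : Hom X Z) (g : Hom Y Z) (c : Hom X0 X)
    (p1 : Hom P X) (p2 : Hom P Y) (r1 : Hom P0 X0) (r2 : Hom P0 Y) (w : Hom P0 P) :
  is_pullback f g p1 p2 -> is_pullback (f ∘ c) g r1 r2 ->
  p1 ∘ w = c ∘ r1 -> p2 ∘ w = r2 ->
  is_pullback c p1 r1 w.
Proof.
intros pb pb0 w1 w2; split; [easy |].
intros T a b E.
destruct (proj2 pb0 T a (p2 ∘ b)) as [h [[h1 h2] uh]].
{ now rewrite <- comp_assoc, E, !comp_assoc, (proj1 pb). }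
exists h; split; [split; [easy |] |].
- apply (is_pullback_jointly_monic _ _ _ _ _ _ f g p1 p2); [easy | |].
  + now rewrite comp_assoc, w1, <- comp_assoc, h1.
  + now rewrite comp_assoc, w2.
- intros k [k1 k2]; apply uh; split; [easy |].
  now rewrite <- w2, <- k2, comp_assoc.
Qed.

(** * Strict weak dependent products *)

(** Precomposing with a section of the comparison from the weak pullback to the
    genuine one turns the evaluation arrow on the former into one on the latter;
    as the evaluation is determined by projections, no information is lost. *)
Lemma strict_weak_dependent_product (C : Category) (B A I : C)
    (g : Hom B A) (f : Hom A I) :
  has_finite_limits C -> has_weak_dependent_products C ->
  exists (U P : C) (u : Hom U I) (p1 : Hom P U) (p2 : Hom P A) (e : Hom P B),
    is_pullback u f p1 p2 /\ g ∘ e = p2 /\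
    forall (U' P' : C) (u' : Hom U' I) (p1' : Hom P' U') (p2' : Hom P' A)
           (e' : Hom P' B),
      is_pullback u' f p1' p2' -> g ∘ e' = p2' ->
      exists (k : Hom U' U) (kA : Hom P' P),
        u ∘ k = u' /\ p1 ∘ kA = k ∘ p1' /\ p2 ∘ kA = p2' /\ e ∘ kA = e'.
Proof.
intros lim wdp.
destruct (wdp _ _ _ g f)
  as [U [V [u [v1 [v2 [e [[ge [vsq vuniv]] [det univ]]]]]]]].
destruct (pullback_exists C _ _ _ u f lim) as [P [p1 [p2 pb]]].
destruct (vuniv P p1 p2 (proj1 pb)) as [s [s1 s2]].
destruct (proj2 pb V v1 v2 vsq) as [d [[d1 d2] _]].
exists U, P, u, p1, p2, (e ∘ s); split; [easy |]; split.
{ now rewrite comp_assoc, ge. }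
intros U' P' u' p1' p2' e' pb' ge'.
destruct (univ U' P' u' p1' p2' e') as [h [l [h1 [h2 [h3 h4]]]]].
{ split; [easy | split; [apply (proj1 pb') |]].
  intros T a b E; destruct (proj2 pb' T a b E) as [t [Et _]]; now exists t. }
{ intros T a b E1 E2; now rewrite (is_pullback_jointly_monic
    _ _ _ _ _ _ _ _ _ _ a b pb' E1 E2). }
exists h, (d ∘ l); repeat split; [easy | | |].
- now rewrite comp_assoc, d1.
- now rewrite comp_assoc, d2.
- rewrite <- h4, comp_assoc, <- (comp_assoc e).
  f_equal.
  (* [s ∘ d] need not be the identity of [V], but has the same projections. *)
  transitivity (e ∘ idm V); [| apply comp_idr].
  apply det; rewrite comp_idr, comp_assoc; [now rewrite s1 | now rewrite s2].
Qed.

Section ModelCategory.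
Variables (C : Category) (M : ModelStructure C).

(** * Fibrations and weak equivalences *)

Lemma weq_idm (X : C) : weq M (idm X).
Proof.
destruct (factor_acof_fib M (idm X)) as [Z [i [p [[_ wi] [_ E]]]]].
apply (@weq_retract _ M _ _ _ _ (idm X) i); [| easy].
exists (idm X), (idm X), i, p; repeat split; now rewrite ?comp_idl, ?E.
Qed.

(** The retract argument: lifting against the first factor of [f] exhibits [f]
    as a retract of its second factor. *)
Lemma fib_of_lifting (X Y : C) (f : Hom X Y) :
  (forall (A B : C) (i : Hom A B), acyclic_cof M i ->
    forall (t : Hom A X) (b : Hom B Y), f ∘ t = b ∘ i ->
    exists l : Hom B X, l ∘ i = t /\ f ∘ l = b) ->
  fib M f.
Proof.
intros lift.
destruct (factor_acof_fib M f) as [Z [i [p [ai [fp E]]]]].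
destruct (lift _ _ i ai (idm X) p) as [l [l1 l2]].
{ now rewrite comp_idr, E. }
apply (@fib_retract _ M _ _ _ _ f p); [| easy].
exists i, l, (idm Y), (idm Y); repeat split; now rewrite ?comp_idl.
Qed.

Lemma fib_comp (X Y Z : C) (f : Hom X Y) (g : Hom Y Z) :
  fib M f -> fib M g -> fib M (g ∘ f).
Proof.
intros ff fg; apply fib_of_lifting; intros A B i ai t b E.
destruct (lift_acof_fib ai fg (t := f ∘ t) (b := b)) as [m [m1 m2]].
{ now rewrite comp_assoc. }
destruct (lift_acof_fib ai ff (t := t) (b := m) (eq_sym m1)) as [l [l1 l2]].
exists l; split; [easy |].
now rewrite <- comp_assoc, l2.
Qed.

Lemma fib_base_change (X Y Z P : C)
    (f : Hom X Z) (g : Hom Y Z) (p1 : Hom P X) (p2 : Hom P Y) :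
  is_pullback f g p1 p2 -> fib M g -> fib M p1.
Proof.
intros pb fg; apply fib_of_lifting; intros A B i ai t b E.
destruct (lift_acof_fib ai fg (t := p2 ∘ t) (b := f ∘ b)) as [m [m1 m2]].
{ now rewrite comp_assoc, <- (proj1 pb), <- !comp_assoc, E. }
destruct (proj2 pb B b m (eq_sym m2)) as [l [[l1 l2] _]].
exists l; split; [| easy].
apply (is_pullback_jointly_monic _ _ _ _ _ _ f g p1 p2); [easy | |].
- now rewrite comp_assoc, l1.
- now rewrite comp_assoc, l2.
Qed.

Lemma lift_cofibrant_afib (X Y Z : C) (q : Hom Y Z) (b : Hom X Z) :
  cofibrant M X -> fib M q -> weq M q -> exists l : Hom X Y, q ∘ l = b.
Proof.
intros [E [t [init ct]]] fq wq.
destruct (init Y) as [y _].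
destruct (init Z) as [z [_ uz]].
destruct (lift_cof_afib ct (conj fq wq) (t := y) (b := b)) as [l [_ Hl]].
{ now rewrite <- (uz (q ∘ y) Logic.I), <- (uz (b ∘ t) Logic.I). }
now exists l.
Qed.

(** * Fibrewise homotopies *)

Lemma fibrewise_path_object_exists (A B : C) (g : Hom B A) :
  exists (BB P : C) (q1 q2 : Hom BB B) (r : Hom B P) (p : Hom P BB),
    is_fibrewise_path_object (fib M) (acyclic_cof M) g q1 q2 r p.
Proof.
destruct (pullback_exists C _ _ _ g g (model_limits M)) as [BB [q1 [q2 pb]]].
destruct (proj2 pb B (idm B) (idm B) eq_refl) as [d [[d1 d2] _]].
destruct (factor_acof_fib M d) as [P [r [p [ar [fp E]]]]].
exists BB, P, q1, q2, r, p; split; [easy |].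
now rewrite E.
Qed.

Lemma fibrewise_homotopic_precomp (A B D D' : C) (g : Hom B A)
    (d d' : Hom D B) (j : Hom D' D) :
  fibrewise_homotopic (fib M) (acyclic_cof M) g d d' ->
  fibrewise_homotopic (fib M) (acyclic_cof M) g (d ∘ j) (d' ∘ j).
Proof.
intros [E [BB [P [q1 [q2 [r [p [po [h [h1 h2]]]]]]]]]]; split.
{ now rewrite !comp_assoc, E. }
exists BB, P, q1, q2, r, p; split; [easy |].
exists (h ∘ j); now rewrite <- h1, <- h2, !comp_assoc.
Qed.

(** A commutative square from [q] to [g] acts on path objects: lift the acyclic
    cofibration [Q -> P_q Q] against the fibration [P_g B -> B ×_A B]. *)
Lemma fibrewise_homotopic_postcomp (A B P Q D : C) (g : Hom B A) (q : Hom Q P)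
    (m : Hom Q B) (b : Hom P A) (d d' : Hom D Q) :
  g ∘ m = b ∘ q ->
  fibrewise_homotopic (fib M) (acyclic_cof M) q d d' ->
  fibrewise_homotopic (fib M) (acyclic_cof M) g (m ∘ d) (m ∘ d').
Proof.
intros sq [E [QQ [PQ [s1 [s2 [r' [p' [[pb' [ar' [_ [e1' e2']]]] [h [h1 h2]]]]]]]]]].
split.
{ now rewrite !comp_assoc, sq, <- !comp_assoc, E. }
destruct (fibrewise_path_object_exists A B g) as [BB [PB [q1 [q2 [r [p po]]]]]].
exists BB, PB, q1, q2, r, p; split; [easy |].
destruct po as [pb [_ [fp [e1 e2]]]].
destruct (proj2 pb PQ (m ∘ s1 ∘ p') (m ∘ s2 ∘ p')) as [n [[n1 n2] _]].
{ now rewrite !comp_assoc, sq, <- !(comp_assoc b), (proj1 pb'). }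
destruct (lift_acof_fib ar' fp (t := r ∘ m) (b := n)) as [l [_ pl]].
{ apply (is_pullback_jointly_monic _ _ _ _ _ _ g g q1 q2); [easy | |].
  - rewrite (comp_assoc q1 n), n1, <- !comp_assoc, e1', comp_idr.
    now rewrite !comp_assoc, <- (comp_assoc q1), e1, comp_idl.
  - rewrite (comp_assoc q2 n), n2, <- !comp_assoc, e2', comp_idr.
    now rewrite !comp_assoc, <- (comp_assoc q2), e2, comp_idl. }
exists (l ∘ h); rewrite (comp_assoc p), pl, !comp_assoc, n1, n2, <- h1, <- h2.
now rewrite !comp_assoc.
Qed.

Section RightProper.
Hypothesis Mproper : right_proper M.
Hypothesis Mcofibrant : forall X : C, cofibrant M X.

(** The fibrewise path object of an acyclic fibration is acyclic over the fibre
    product, so cofibrant objects cannot tell apart two points of a fibre. *)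
Lemma fibrewise_homotopic_afib (P Q D : C) (q : Hom Q P) (d d' : Hom D Q) :
  fib M q -> weq M q -> q ∘ d = q ∘ d' ->
  fibrewise_homotopic (fib M) (acyclic_cof M) q d d'.
Proof.
intros fq wq E; split; [easy |].
destruct (fibrewise_path_object_exists P Q q) as [QQ [PQ [q1 [q2 [r [p po]]]]]].
exists QQ, PQ, q1, q2, r, p; split; [easy |].
destruct po as [pb [[_ wr] [fp [e1 e2]]]].
assert (wp : weq M p).
{ apply (@weq_cancel_r _ M _ _ _ r p); [easy |].
  apply (@weq_cancel_l _ M _ _ _ (p ∘ r) q2).
  - now apply (Mproper _ _ _ _ q q q1 q2).
  - rewrite e2; apply weq_idm. }
destruct (proj2 pb D d d' E) as [n [[n1 n2] _]].
destruct (lift_cofibrant_afib _ _ _ p n (Mcofibrant D) fp wp) as [h Eh].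
exists h; now rewrite Eh.
Qed.

(** Factor [w] as an acyclic cofibration [j] followed by a fibration [q], which
    is acyclic.  Then [t] extends strictly along [j], to [m], and precomposing
    [m] with a section [s] of [q] loses nothing up to homotopy, since [s ∘ q] is
    homotopic to the identity over the codomain of [q]. *)
Lemma homotopy_extension_along_weq (A B X Y : C) (g : Hom B A) (w : Hom X Y)
    (t : Hom X B) (b : Hom Y A) :
  fib M g -> weq M w -> g ∘ t = b ∘ w ->
  exists e : Hom Y B, g ∘ e = b /\
    fibrewise_homotopic (fib M) (acyclic_cof M) g (e ∘ w) t.
Proof.
intros fg ww E.
destruct (factor_acof_fib M w) as [Q [j [q [aj [fq Ew]]]]].
assert (wq : weq M q).
{ apply (@weq_cancel_r _ M _ _ _ j q); [apply aj | now rewrite Ew]. }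
destruct (lift_cofibrant_afib _ _ _ q (idm Y) (Mcofibrant Y) fq wq) as [s qs].
destruct (lift_acof_fib aj fg (t := t) (b := b ∘ q)) as [m [mj gm]].
{ now rewrite <- comp_assoc, Ew. }
exists (m ∘ s); split.
{ now rewrite comp_assoc, gm, <- comp_assoc, qs, comp_idr. }
rewrite <- mj, <- Ew.
replace (m ∘ s ∘ (q ∘ j)) with (m ∘ (s ∘ q ∘ j)) by now rewrite !comp_assoc.
apply (fibrewise_homotopic_postcomp _ _ _ _ _ g q m b); [easy |].
apply fibrewise_homotopic_afib; [easy | easy |].
now rewrite !comp_assoc, qs, comp_idl.
Qed.

(** * Homotopy weak dependent products in the model category *)

Lemma has_homotopy_weak_dependent_products_model :
  has_weak_dependent_products C ->
  has_homotopy_weak_dependent_products (fib M) (acyclic_cof M).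
Proof.
intros wdp B A I g f fg ff.
destruct (strict_weak_dependent_product C B A I g f (model_limits M) wdp)
  as [U0 [P0 [u0 [r1 [r2 [e0 [pb0 [ge0 univ]]]]]]]].
destruct (factor_acof_fib M u0) as [U [c [u [[_ wc] [fu Eu]]]]].
subst u0.
destruct (pullback_exists C _ _ _ u f (model_limits M)) as [P [p1 [p2 pb]]].
destruct (proj2 pb P0 (c ∘ r1) r2) as [w [[w1 w2] _]].
{ rewrite comp_assoc; apply pb0. }
assert (ww : weq M w).
{ apply (Mproper _ _ _ _ c p1 r1 w); [| easy |].
  - now apply (is_pullback_cancel C _ _ _ _ _ _ u f c p1 p2 r1 r2).
  - now apply (fib_base_change _ _ _ _ u f p1 p2). }
destruct (homotopy_extension_along_weq A B P0 P g w e0 p2) as [e [ge he]];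
  [easy | easy | now rewrite w2 |].
exists U, P, u, p1, p2, e; repeat split; [easy | apply pb | apply pb | easy |].
intros U' P' u' p1' p2' e' _ pb' ge'.
destruct (univ U' P' u' p1' p2' e' pb' ge') as [h [hA [h1 [h2 [h3 h4]]]]].
exists (c ∘ h), (w ∘ hA); split; [| split; [| split]].
- now rewrite comp_assoc.
- now rewrite comp_assoc, w1, <- !comp_assoc, h2.
- now rewrite comp_assoc, w2.
- rewrite <- h4, comp_assoc.
  now apply fibrewise_homotopic_precomp.
Qed.

End RightProper.

(** * Restriction to fibrant objects *)

Lemma fibrant_of_fib (X Y : C) (p : Hom Y X) :
  fib M p -> fibrant M X -> fibrant M Y.
Proof.
intros fp [T [t [term ft]]].
exists T, (t ∘ p); split; [easy | now apply fib_comp].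
Qed.

Lemma is_pullback_fibrant (X Y Z P : fibrant_subcategory M)
    (f : Hom X Z) (g : Hom Y Z) (p1 : Hom P X) (p2 : Hom P Y) :
  @is_pullback C _ _ _ _ f g p1 p2 -> is_pullback f g p1 p2.
Proof. intros [sq univ]; split; [exact sq | intros T; apply univ]. Qed.

(** The pullback in the model category is fibrant, as [g] is a fibration, so it
    is isomorphic to the given pullback of fibrant objects. *)
Lemma is_pullback_of_fibrant (X Y Z P : fibrant_subcategory M)
    (f : Hom X Z) (g : Hom Y Z) (p1 : Hom P X) (p2 : Hom P Y) :
  fibrant_fib g -> is_pullback f g p1 p2 -> @is_pullback C _ _ _ _ f g p1 p2.
Proof.
intros fg pb.
destruct (pullback_exists C _ _ _ f g (model_limits M)) as [R [r1 [r2 pbR]]].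
assert (fr1 : fib M r1) by exact (fib_base_change _ _ _ _ _ _ _ _ pbR fg).
assert (fibR : fibrant M R) by exact (fibrant_of_fib _ _ _ fr1 (proj2_sig X)).
destruct (proj2 pbR _ p1 p2 (proj1 pb)) as [m [[m1 m2] _]].
destruct (proj2 pb (exist _ R fibR) r1 r2 (proj1 pbR)) as [n [[n1 n2] _]].
simpl in n, n1, n2.
assert (nm : n ∘ m = idm (proj1_sig P)).
{ apply (is_pullback_jointly_monic _ _ _ _ P P f g p1 p2 (n ∘ m) (idm P) pb); simpl.
  - now rewrite comp_assoc, n1, m1, comp_idr.
  - now rewrite comp_assoc, n2, m2, comp_idr. }
split; [exact (proj1 pb) |].
intros T a b E.
destruct (proj2 pbR T a b E) as [h [[h1 h2] uh]].
exists (n ∘ h); split.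
- now rewrite !comp_assoc, n1, n2.
- intros k [k1 k2].
  rewrite (uh (m ∘ k)), comp_assoc, nm, comp_idl; [easy |].
  now rewrite !comp_assoc, m1, m2.
Qed.

Lemma fibrewise_homotopic_fibrant (A B D : fibrant_subcategory M)
    (g : Hom B A) (d d' : Hom D B) :
  fibrant_fib g ->
  @fibrewise_homotopic C (fib M) (acyclic_cof M) _ _ _ g d d' ->
  fibrewise_homotopic (@fibrant_fib C M) (@fibrant_acyclic_cof C M) g d d'.
Proof.
intros fg [E [BB [P [q1 [q2 [r [p [[pb [ar [fp [e1 e2]]]] hh]]]]]]]].
assert (fq1 : fib M q1) by exact (fib_base_change _ _ _ _ _ _ _ _ pb fg).
assert (fBB : fibrant M BB) by exact (fibrant_of_fib _ _ _ fq1 (proj2_sig B)).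
assert (fP : fibrant M P) by exact (fibrant_of_fib _ _ _ fp fBB).
split; [exact E |].
exists (exist _ BB fBB), (exist _ P fP), q1, q2, r, p; split; [| exact hh].
split; [now apply is_pullback_fibrant | easy].
Qed.

End ModelCategory.

Theorem corollary4p4 (C : Category) (M : ModelStructure C)
    (Mproper : right_proper M)
    (Mcofibrant : forall X : C, cofibrant M X)
    (Mwdp : has_weak_dependent_products C) :
  has_homotopy_weak_dependent_products (@fibrant_fib C M) (@fibrant_acyclic_cof C M).
Proof.
intros B A I g f fg ff.
destruct (has_homotopy_weak_dependent_products_model C M Mproper Mcofibrant Mwdp
  _ _ _ g f fg ff) as [U [P [u [p1 [p2 [e [fu [pb [ge univ]]]]]]]]].
assert (fp1 : fib M p1) by exact (fib_base_change C M _ _ _ _ _ _ _ _ pb ff).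
assert (fU : fibrant M U) by exact (fibrant_of_fib C M _ _ _ fu (proj2_sig I)).
assert (fP : fibrant M P) by exact (fibrant_of_fib C M _ _ _ fp1 fU).
exists (exist _ U fU), (exist _ P fP), u, p1, p2, e.
split; [exact fu | split; [now apply is_pullback_fibrant | split; [exact ge |]]].
intros U' P' u' p1' p2' e' fu' pb' ge'.
destruct (univ _ _ u' p1' p2' e' fu'
  (is_pullback_of_fibrant C M _ _ _ _ _ _ _ _ ff pb') ge')
  as [k [kA [k1 [k2 [k3 hk]]]]].
exists k, kA; split; [exact k1 | split; [exact k2 | split; [exact k3 |]]].
now apply fibrewise_homotopic_fibrant.
Qed.
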